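(* Let $X_n\in\mathbb R^{n\times p}$ be a random matrix with i.i.d. entries distributed as $\mathcal N(0,1)$. Fix a number $r\ge0$, and assume that $n>p+r-1$. Then there exist (explicitly known) constants $c_1(r),c_3(r)>0$ and $c_2\in(0,1)$ such that $$\mathbb E\big[s_{\min}(X_n)^{-r}\big]\le\frac{c_1(r)}{(n-p-1)^{r/2}}+\frac{c_3(r)\,c_2^{(n-p-r+1)/2}}{(n-p-1)^{(r-4)/2}}.$$ In particular, if $p/n\to\gamma\in[0,1)$, then there exists a universal constant $K_2(r)>0$ (depending only on $r$ and $\gamma$) such that $$\mathbb E\left[\left(\frac{\sqrt n}{s_{\min}(X_n)}\right)^r\right]\le K_2(r).$$
   Context: For $A\in\mathbb R^{n\times p}$, $s_{\min}(A)$ is the $\min(n,p)$-th singular value of $A$ when the singular values are arranged in descending order. In the last claim $p=p_n$ may depend on $n$ and the limit is taken as $n\to\infty$.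
   Formalization: c_1, c_3 cannot depend on r alone uniformly in n, p: here they depend on r and any bound γ_0<1 with p/n≤γ_0 (c_2 is absolute). Also p≥1 and n>p+1 are assumed, the second bound is for all sufficiently large n, and constants are only shown to exist. *)

(* Defs.v *)
From HB Require Import structures.
From mathcomp Require Import all_boot all_order all_algebra.
From mathcomp Require Import polyrcf.
From mathcomp Require Import all_classical all_reals all_analysis.

Set Implicit Arguments.
Unset Strict Implicit.
Unset Printing Implicit Defensive.

Import Order.TTheory GRing.Theory Num.Theory.
Import numFieldNormedType.Exports.

Local Open Scope classical_set_scope.
Local Open Scope ring_scope.

(* The real roots of the characteristic polynomial of M, each listed as often
   as its algebraic multiplicity. For a symmetric real matrix of size p this is
   the full list of its p eigenvalues. *)
Definition eigenvalues (R : realType) (p : nat) (M : 'M[R]_p) : seq R :=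
  flatten [seq nseq (mup x (char_poly M)) x | x <- rootsR (char_poly M)].

(* Descending square roots of the p eigenvalues of A^T A. Only the first
   min(n, p) entries are singular values in the usual sense; when n < p the
   other p - n entries are zero. *)
Definition singular_values (R : realType) (n p : nat) (A : 'M[R]_(n, p)) :
    seq R :=
  sort >=%R [seq Num.sqrt x | x <- eigenvalues (A^T *m A)].

(* Positions are counted from 0, hence the predecessor. The value is
   meaningful only when 0 < minn n p. *)
Definition smin (R : realType) (n p : nat) (A : 'M[R]_(n, p)) : R :=
  nth 0 (singular_values A) (minn n p).-1.

Definition mutually_independent (d : measure_display) (T : measurableType d)
    (R : realType) (P : probability T R) (I : finType)
    (X : I -> {RV P >-> R}) : Prop :=
  forall (J : {set I}) (B : I -> set R),
    (forall i, measurable (B i)) ->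
    P (\bigcap_(i in [set` J]) (X i @^-1` B i)) =
      (\prod_(i in J) P (X i @^-1` B i))%E.

Definition random_matrix (d : measure_display) (T : measurableType d)
    (R : realType) (P : probability T R) (n p : nat)
    (X : 'I_n -> 'I_p -> {RV P >-> R}) (w : T) : 'M[R]_(n, p) :=
  \matrix_(i < n, j < p) X i j w.

Definition iid_standard_normal (d : measure_display) (T : measurableType d)
    (R : realType) (P : probability T R) (n p : nat)
    (X : 'I_n -> 'I_p -> {RV P >-> R}) : Prop :=
  mutually_independent (fun ij : 'I_n * 'I_p => X ij.1 ij.2) /\
  (forall i j (B : set R), measurable B ->
     distribution P (X i j) B = normal_prob 0 1 B).

(* E[(a / s_min(X))^r] as an integral in [0, +oo]. The quotient is taken in the
   extended reals, so that a / 0 = +oo for a > 0 and a singular sample counts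
   as +oo when r > 0; with division in R, a / 0 would be 0. *)
Definition smin_neg_moment (d : measure_display) (T : measurableType d)
    (R : realType) (P : probability T R) (n p : nat)
    (X : 'I_n -> 'I_p -> {RV P >-> R}) (a r : R) : \bar R :=
  (\int[P]_w (a%:E / (smin (random_matrix X w))%:E) `^ r)%E.

(* Main.v *)
Require Import Defs.
From HB Require Import structures.
From mathcomp Require Import all_boot all_order all_algebra.
From mathcomp Require Import polyrcf spectral complex.
From mathcomp Require Import all_classical all_reals all_analysis.
From mathcomp Require Import measurable_realfun.
From mathcomp Require Import zify ring lra.

Set Implicit Arguments.
Unset Strict Implicit.
Unset Printing Implicit Defensive.

Import Order.TTheory GRing.Theory Num.Theory.
Import numFieldNormedType.Exports.
Local Open Scope classical_set_scope.
Local Open Scope ring_scope.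

(** Everything follows from one scale-free bound: if p / n <= g0 < 1 and
    n - p + 1 > r, then the r-th moment of sqrt n / smin(X) is at most a
    constant depending on r and g0 only (smin_neg_moment_le). The first claim
    follows by comparing n with n - p - 1, the second by taking g0 halfway
    between gamma and 1.

    The bound comes from a small-ball estimate with the exact exponent
    m = n - p + 1, namely P(smin(X) <= sqrt n / L) <= C^n / L^m for every
    integer L >= 2 (single_scale_majorant). Summing it over L = 2^l against
    L^r converges because m > r. The constant C^n is harmless: m >= (1 - g0) n,
    so it is absorbed when the sum starts at a scale l0 with l0 (1 - g0) > 16, and
    where sqrt n / smin(X) is below 2^l0 the trivial bound 2^(l0 r) is used.

    For the small-ball estimate, smin(A) = |A v| for some unit vector v
    (smin_attained, from the real spectral theorem). Rescale v to norm about
    sqrt p so that one of its coordinates is an integer, and round the other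
    p - 1 coordinates to multiples of 1/L. Rounding one coordinate at a time,
    each time in the direction in which the linear part of |A y|^2 decreases,
    costs only the quadratic terms, in total at most |A|_F^2 / L^2
    (round_coordinates); so the Frobenius norm, rather than the operator norm,
    controls the error. The rounded vectors form a net of at most C^p L^(p-1)
    points; leaving one coordinate on the integers is what saves a factor L and
    gives the exact exponent m (net_exists).

    A union bound over the net requires the expectation of
    exp(- lam |X y|^2 + bet |X|_F^2) for fixed y, with lam = L^2 / (16 p) and
    bet = 1 / (16 p). The term in bet pays for the rounding error, and it costs
    only a constant factor per row. Its exact value is a Gaussian integral,
    computed by integrating out the entries of X one at a time: the exponent
    keeps its shape, with a new lam in the row concerned
    (integral_gauss_step, integral_gauss_matrix). It is at most (C / L)^n, and
    C^p L^(p-1) (C / L)^n is the announced bound.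

    The small-ball estimate is expressed through a measurable majorant of the
    indicator of the event, namely the sum over the net of the exponentials
    above; it bounds the moment through the monotonicity of the integral
    (ge0_le_integralT). *)

(** * Gaussian integrals on the line *)

(** The integral of a nonnegative function is the supremum of the integrals of
    the simple functions below it, so monotonicity holds without
    measurability. *)
Lemma ge0_le_integralT d (T : measurableType d) (R : realType)
    (mu : {measure set T -> \bar R}) (f g : T -> \bar R) :
  (forall x, 0 <= f x)%E -> (forall x, f x <= g x)%E ->
  (\int[mu]_x f x <= \int[mu]_x g x)%E.
Proof.
move=> f0 fg; have g0 x : (0 <= g x)%E by exact: le_trans (f0 x) (fg x).
rewrite !ge0_integralTE//; apply: le_ereal_sup => _ [h /= hf <-].
by exists h => //= x; exact: le_trans (hf x) (fg x).
Qed.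

(** The density of the normal law agrees almost everywhere with its
    Radon-Nikodym derivative, for which the change of variables is known. *)
Lemma ge0_integral_normal_prob (R : realType) (m s : R) (f : _ -> \bar R) :
  measurable_fun setT f -> (forall x, 0 <= f x)%E ->
  (\int[normal_prob m s]_x f x =
   \int[lebesgue_measure]_x (f x * (normal_pdf m s x)%:E))%E.
Proof.
move=> mf f0.
have dom := normal_prob_dominates m s.
rewrite -(Radon_Nikodym_SigmaFinite.change_of_variables dom)//.
have mpdf : measurable_fun setT (fun x => (normal_pdf m s x)%:E).
  by apply/measurable_EFinP; exact: measurable_normal_pdf.
have mRN : measurable_fun setT
    (Radon_Nikodym_SigmaFinite.f (normal_prob m s) (@lebesgue_measure R)).
  by apply: measurable_int; exact: Radon_Nikodym_SigmaFinite.f_integrable.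
apply: ae_eq_integral => //.
- exact: emeasurable_funM.
- exact: emeasurable_funM.
apply: ae_eqe_mul2l; apply: integral_ae_eq => //.
  exact: Radon_Nikodym_SigmaFinite.f_integrable.
by move=> A _ mA; rewrite -Radon_Nikodym_SigmaFinite.f_integral.
Qed.

(** Completing the square turns the integrand times the standard normal density
    into a multiple of the normal density of variance 1 / (k + 2 lam y^2). *)
Lemma integral_normal_prob_quadratic (R : realType) (lam bet y b : R) :
  0 <= lam -> bet < 2^-1 ->
  let k := 1 - 2 * bet in
  (\int[normal_prob 0 1]_x (expR (- lam * (y * x + b) ^+ 2 + bet * x ^+ 2))%:E =
   ((Num.sqrt (k + 2 * lam * y ^+ 2))^-1 *
    expR (- (lam * k / (k + 2 * lam * y ^+ 2)) * b ^+ 2))%:E)%E.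
Proof.
move=> lam0 bet2 k; set v := k + 2 * lam * y ^+ 2.
have k0 : 0 < k by rewrite /k; lra.
have v0 : 0 < v by rewrite /v ltr_pwDl// mulr_ge0 ?sqr_ge0// mulr_ge0.
rewrite ge0_integral_normal_prob/=; last 2 first.
- apply/measurable_EFinP; apply: measurableT_comp => //.
  apply: measurable_funD; apply: measurable_funM => //; apply: measurable_funX => //.
  by apply: measurable_funD => //; apply: measurable_funM.
- by move=> x; rewrite lee_fin expR_ge0.
pose m' := - (2 * lam * y * b) / v; pose s' := (Num.sqrt v)^-1.
have s'0 : s' != 0 by rewrite gt_eqF// invr_gt0 sqrtr_gt0.
have s'2 : s' ^+ 2 = v^-1 by rewrite /s' exprVn sqr_sqrtr// ltW.
set C := (X in X%:E).
transitivity (\int[lebesgue_measure]_x (C%:E * (normal_pdf m' s' x)%:E))%E.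
  apply: eq_integral => x _; rewrite -!EFinM; congr EFin.
  rewrite !normal_pdfE ?oner_eq0//= /normal_peak /normal_fun s'2.
  have -> : (Num.sqrt (1 ^+ 2 * pi *+ 2))^-1 =
      (Num.sqrt v)^-1 * (Num.sqrt (v^-1 * pi *+ 2))^-1 :> R.
    rewrite -invfM -sqrtrM; last exact: ltW.
    by congr (Num.sqrt _)^-1; field; rewrite gt_eqF.
  rewrite mulrCA -expRD; set e := (X in expR X).
  have -> : e = - (lam * k / v) * b ^+ 2 + - (x - m') ^+ 2 / (v^-1 *+ 2).
    rewrite /e /m'; have -> : bet = (1 - k) / 2 by rewrite /k; field.
    have -> : k = v - 2 * lam * y ^+ 2 by rewrite /v; ring.
    by field; rewrite gt_eqF.
  by rewrite expRD /C; ring.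
rewrite ge0_integralZl//.
- by rewrite integral_normal_pdf mule1.
- by apply/measurable_EFinP; exact: measurable_normal_pdf.
- by move=> x _; rewrite lee_fin normal_pdf_ge0.
- by rewrite lee_fin /C mulr_ge0 ?expR_ge0// invr_ge0 sqrtr_ge0.
Qed.

(** * Integrating out one of several independent Gaussian variables *)

(** A pi-system generating the sigma-algebra of all the [X i] with [i != i0]. *)
Definition cylinders_avoiding (d : measure_display) (T : measurableType d)
    (R : realType) (P : probability T R) (I : finType)
    (X : I -> {RV P >-> R}) (i0 : I) : set (set T) :=
  [set A | exists2 B : I -> set R, (forall i, measurable (B i)) &
     A = \bigcap_(i in [set i | i != i0]) (X i @^-1` B i)].

Lemma measurable_cylinders_avoiding d (T : measurableType d)
    (R : realType) (P : probability T R) (I : finType)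
    (X : I -> {RV P >-> R}) (i0 : I) :
  <<s cylinders_avoiding X i0 >> `<=` measurable.
Proof.
apply: smallest_sub; first exact: sigma_algebra_measurable.
move=> _ [B mB ->]; apply: fin_bigcap_measurable; first exact: finite_finset.
by move=> i _; rewrite -[X in measurable X]setTI; exact: measurable_funP.
Qed.

(** On the generating pi-system this is mutual independence, where [i0] is
    assigned the event [B]; both sides are finite measures in [A], so they agree
    on the generated sigma-algebra. *)
Lemma independent_cylinders_avoiding d (T : measurableType d)
    (R : realType) (P : probability T R) (I : finType)
    (X : I -> {RV P >-> R}) (i0 : I) (A : set T) (B : set R) :
  mutually_independent X -> <<s cylinders_avoiding X i0 >> A -> measurable B ->
  P (X i0 @^-1` B `&` A) = (P (X i0 @^-1` B) * P A)%E.
Proof.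
move=> indX sA mB.
have mD : measurable (X i0 @^-1` B).
  by rewrite -[X in measurable X]setTI; exact: measurable_funP.
have pD0 : 0 <= fine (P (X i0 @^-1` B)) by rewrite fine_ge0.
have -> : P (X i0 @^-1` B `&` A) = mrestr P mD A by rewrite setIC.
transitivity (mscale (NngNum pD0) P A); last first.
  by rewrite /mscale/= fineK// fin_num_measure.
apply: (g_sigma_algebra_measure_unique (cylinders_avoiding X i0) _ (fun=> setT)) sA.
- by move=> C GC; apply: (@measurable_cylinders_avoiding _ _ _ _ _ X i0);
    exact: sub_sigma_algebra.
- move=> _; exists (fun=> setT) => //.
  by apply/esym; rewrite bigcapT.
- by rewrite bigcup_const//; exists 0%N.
- move=> _ _ [B1 mB1 ->] [B2 mB2 ->]; exists (fun i => B1 i `&` B2 i).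
    by move=> i; exact: measurableI.
  by rewrite -bigcapI; apply: eq_bigcapr.
- move=> _ [B1 mB1 ->]; rewrite /= /mrestr /mscale /= fineK ?fin_num_measure//.
  pose B' i := if i == i0 then B else B1 i.
  have mB' i : measurable (B' i) by rewrite /B'; case: ifP.
  have := indX (finset.setT : {set I}) B' mB'.
  have := indX (finset.finset (fun i => i != i0)) B1 mB1.
  have -> : [set` finset.finset (fun i => i != i0)] = [set i | i != i0].
    by apply/seteqP; split => i /=; rewrite inE.
  move=> ->.
  have -> : [set` (finset.setT : {set I})] = setT.
    by apply/seteqP; split => i //=; rewrite inE.
  rewrite (bigD1 i0) ?finset.in_setT//= [B' i0]/B' eqxx => e.
  rewrite [X in (_ * X)%E](_ : _ =
      \prod_(i in finset.setT | i != i0) P (X i @^-1` B' i))%E; last first.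
    apply: eq_big => i; first by rewrite !inE.
    by rewrite inE /B' => /negbTE->.
  rewrite -e; congr (P _); apply/seteqP; split => w /=.
    move=> [w1 w2] i _ /=; rewrite /B'; case: ifPn => [/eqP->//|/w1]; exact.
  move=> wB; split; last by have := wB i0 Logic.I; rewrite /= /B' eqxx.
  by move=> i /= /negbTE ii0; have := wB i Logic.I; rewrite /= /B' ii0.
- move=> _; rewrite /= /mrestr.
  apply: le_lt_trans (probability_le1 _ _) _; last exact: ltry.
  exact: measurableI.
Qed.

(** The variable [X i0] may be replaced by an independent copy: the joint law of
    [X i0] and of the identity into the sigma-algebra of the other variables is
    a product measure, and Tonelli applies. The second argument of [f] is the
    sample point itself, so that [f] may depend on all the other variables
    without a product space being introduced for them. *)
Lemma integral_resample_normal d (T : measurableType d)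
    (R : realType) (P : probability T R) (I : finType)
    (X : I -> {RV P >-> R}) (i0 : I)
    (f : measurableTypeR R * g_sigma_algebraType (cylinders_avoiding X i0) -> \bar R) :
  mutually_independent X ->
  (forall B : set R, measurable B ->
     distribution P (X i0) B = normal_prob 0 1 B) ->
  measurable_fun setT f -> (forall z, 0 <= f z)%E ->
  (\int[P]_w f (X i0 w, w) = \int[P]_w \int[normal_prob 0 1]_x f (x, w))%E.
Proof.
move=> indX X0N mf f0.
set G := cylinders_avoiding X i0 in f mf f0 *.
pose T' := g_sigma_algebraType G.
pose idT : T -> T' := idfun.
pose h : T -> measurableTypeR R * T' := fun w => ((X i0 w : measurableTypeR R), idT w).
have mid : measurable_fun setT idT.
  move=> _ B mB; rewrite setTI.
  exact: (@measurable_cylinders_avoiding _ _ _ _ _ X i0).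
have mX0 : measurable_fun setT (X i0 : T -> measurableTypeR R).
  by move=> mT B mB; exact: (@measurable_funP _ _ _ _ _ (X i0)).
have mh : measurable_fun setT h by exact: measurable_fun_pair.
pose m1 : probability _ R := @normal_prob R 0 1.
pose m2 : probability _ R := distribution P (mfun_Sub (mem_set mid)).
pose m12 : probability _ R := distribution P (mfun_Sub (mem_set mh)).
have e (A : set (measurableTypeR R * T')) : measurable A ->
    (m1 \x m2)%E A = m12 A.
  apply: product_measure_unique => B C mB mC.
  rewrite /m1 /m2 /m12 /= /distribution /pushforward /=.
  rewrite -X0N// -(independent_cylinders_avoiding indX mC mB).
  by congr (P _).
transitivity (\int[m12]_z f z)%E.
  by rewrite ge0_integral_distribution.
rewrite (eq_measure_integral (m1 \x m2)%E); last first.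
  by move=> A mA _; exact/esym/e.
rewrite fubini_tonelli2//.
rewrite ge0_integral_distribution//; last first.
  by move=> w; apply: integral_ge0 => x _; exact: f0.
exact: measurable_fun_fubini_tonelli_G.
Qed.

Lemma measurable_fun_avoiding d (T : measurableType d)
    (R : realType) (P : probability T R) (I : finType)
    (X : I -> {RV P >-> R}) (i0 i : I) : i != i0 ->
  measurable_fun setT (X i : g_sigma_algebraType (cylinders_avoiding X i0) -> R).
Proof.
move=> ii0 _ B mB; rewrite setTI; apply: sub_sigma_algebra.
exists (fun j => if j == i then B else setT); first by move=> j; case: ifP.
apply/seteqP; split => w /=.
  by move=> XB j /= _; case: eqP => [->|].
by move=> /(_ i); rewrite /= eqxx; exact.
Qed.

(** Integrating out one entry leaves an integrand of the same shape, with [lam]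
    replaced by [lam * k / (k + 2 * lam * y ^+ 2)]: this stability is what allows
    the step to be iterated. *)
Lemma integral_gauss_step d (T : measurableType d)
    (R : realType) (P : probability T R) (I : finType)
    (X : I -> {RV P >-> R}) (i0 : I)
    (U V : g_sigma_algebraType (cylinders_avoiding X i0) -> R) (lam bet y : R) :
  mutually_independent X ->
  (forall B : set R, measurable B ->
     distribution P (X i0) B = normal_prob 0 1 B) ->
  measurable_fun setT U -> measurable_fun setT V ->
  0 <= lam -> bet < 2^-1 ->
  let k := 1 - 2 * bet in
  (\int[P]_w (expR (- lam * (y * X i0 w + U w) ^+ 2 + bet * X i0 w ^+ 2 + V w))%:E =
   ((Num.sqrt (k + 2 * lam * y ^+ 2))^-1)%:E *
   \int[P]_w (expR (- (lam * k / (k + 2 * lam * y ^+ 2)) * U w ^+ 2 + V w))%:E)%E.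
Proof.
move=> indX X0N mU mV lam0 bet2 k.
set T' := g_sigma_algebraType _ in U V mU mV *.
pose f := fun z : measurableTypeR R * T' =>
  (expR (- lam * (y * z.1 + U z.2) ^+ 2 + bet * z.1 ^+ 2 + V z.2))%:E.
have mU2 : measurable_fun setT (fun z : measurableTypeR R * T' => U z.2).
  exact: measurableT_comp mU measurable_snd.
have mV2 : measurable_fun setT (fun z : measurableTypeR R * T' => V z.2).
  exact: measurableT_comp mV measurable_snd.
have m1 : measurable_fun setT (fun z : measurableTypeR R * T' => (z.1 : R)).
  exact: measurable_fst.
have mf : measurable_fun setT f.
  apply/measurable_EFinP; apply: measurableT_comp => //.
  apply: measurable_funD => //; apply: measurable_funD.
    apply: measurable_funM => //; apply: measurable_funX.
    by apply: measurable_funD => //; apply: measurable_funM.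
  by apply: measurable_funM => //; apply: measurable_funX.
have f0 z : (0 <= f z)%E by rewrite lee_fin expR_ge0.
rewrite (integral_resample_normal indX X0N mf f0) /f /=.
have lift (W : T -> R) : measurable_fun setT (W : T' -> R) -> measurable_fun setT W.
  move=> mW mT B mB; rewrite setTI.
  apply: (@measurable_cylinders_avoiding _ _ _ _ _ X i0).
  by have := mW measurableT B mB; rewrite setTI.
rewrite -ge0_integralZl; first last.
- by rewrite lee_fin invr_ge0 sqrtr_ge0.
- by move=> w _; rewrite lee_fin expR_ge0.
- apply/measurable_EFinP; apply: measurableT_comp => //.
  apply: measurable_funD; last exact: lift.
  by apply: measurable_funM => //; apply: measurable_funX; exact: lift.
- exact: measurableT.
apply: eq_integral => w _.
under eq_integral do rewrite expRD mulrC EFinM.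
rewrite ge0_integralZl; first last.
- by rewrite lee_fin expR_ge0.
- by move=> x _; rewrite lee_fin expR_ge0.
- apply/measurable_EFinP; apply: measurableT_comp => //.
  apply: measurable_funD; apply: measurable_funM => //; apply: measurable_funX => //.
  by apply: measurable_funD => //; apply: measurable_funM.
- exact: measurableT.
rewrite integral_normal_prob_quadratic// -!EFinM; congr EFin.
by rewrite mulrCA mulrC [in RHS]expRD; ring.
Qed.

(** * The Gaussian integral attached to a fixed vector *)

Lemma measurable_sum_cond d (T : measurableType d) (R : realType) (I : Type)
    (s : seq I) (Q : pred I) (D : set T) (h : I -> T -> R) :
  (forall i, Q i -> measurable_fun D (h i)) ->
  measurable_fun D (fun x => \sum_(i <- s | Q i) h i x).
Proof.
move=> mh.
rewrite (_ : (fun x => _) = fun x => \sum_(i <- s) if Q i then h i x else 0).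
  apply: (@measurable_sum _ _ _ _ _ _ (fun i x => if Q i then h i x else 0)) => i.
  by case Qi : (Q i); [exact: mh | exact: measurable_cst].
by apply/funext => x; rewrite big_mkcond.
Qed.

(** Iteration of the previous step over all the entries. The inverse of the
    coefficient of a row grows by [2 * y j ^+ 2 / k] with each of its entries, so
    the factors telescope. *)
Lemma integral_gauss_matrix d (T : measurableType d) (R : realType)
    (P : probability T R) (n p : nat) (X : 'I_n -> 'I_p -> {RV P >-> R})
    (y : 'I_p -> R) (lam bet : R) :
  iid_standard_normal X -> 0 < lam -> bet < 2^-1 ->
  let k := 1 - 2 * bet in
  (\int[P]_w (expR (\sum_i (- lam * (\sum_j y j * X i j w) ^+ 2)
      + bet * \sum_i \sum_j X i j w ^+ 2))%:E =
   ((Num.sqrt k)^-1 ^+ (n * p) *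
    (Num.sqrt (1 + 2 * lam / k * \sum_j y j ^+ 2))^-1 ^+ n)%:E)%E.
Proof.
move=> [indX XN] lam0 bet2 k.
have k0 : 0 < k by rewrite /k; lra.
pose Y (ij : 'I_n * 'I_p) := X ij.1 ij.2.
(* The entries in s have been integrated out; L s i is the coefficient of row i
   at that stage and c s the factor produced so far. *)
pose D (s : seq ('I_n * 'I_p)) i := 1 + 2 * lam / k * \sum_(j | (i, j) \in s) y j ^+ 2.
have D0 s i : 0 < D s i.
  rewrite ltr_pwDl//; apply: mulr_ge0.
    by rewrite ltW// divr_gt0// mulr_gt0.
  by apply: sumr_ge0 => j _; exact: sqr_ge0.
pose L s i := lam / D s i.
have L0 s i : 0 < L s i by rewrite divr_gt0.
pose E s w := \sum_i (- L s i * (\sum_(j | (i, j) \notin s) y j * X i j w) ^+ 2)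
  + bet * \sum_(ij | ij \notin s) Y ij w ^+ 2.
pose c s := \prod_i (Num.sqrt (D s i))^-1 * (Num.sqrt k)^-1 ^+ size s.
suff H s : uniq s -> (\int[P]_w (expR (E [::] w))%:E =
    (c s)%:E * \int[P]_w (expR (E s w))%:E)%E.
  have := H _ (enum_uniq {: 'I_n * 'I_p}).
  have -> : (\int[P]_w (expR (E (enum {: 'I_n * 'I_p}) w))%:E = 1)%E.
    transitivity (\int[P]_w (cst 1%E w))%E; last first.
      by rewrite integral_cst// mul1e; exact: probability_setT.
    apply: eq_integral => w _; rewrite /E big1 ?add0r => [|i _]; last first.
      by rewrite big_pred0 ?expr0n ?mulr0// => j; rewrite mem_enum.
    by rewrite big_pred0 ?mulr0 ?expR0// => ij; rewrite mem_enum.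
  rewrite mule1 => e.
  transitivity (\int[P]_w (expR (E [::] w))%:E)%E.
    apply: eq_integral => w _; rewrite /E; congr (expR _)%:E.
    congr (_ + bet * _); last by rewrite pair_bigA.
    apply: eq_bigr => i _; rewrite /L /D [X in 1 + _ * X]big_pred0// mulr0 addr0 divr1.
    by congr (_ * _ ^+ 2); exact: eq_bigl.
  apply: etrans e _; rewrite /c -cardE card_prod !card_ord mulrC; congr (_ * _)%:E.
  rewrite -[in RHS](card_ord n) -prodr_const; apply: eq_bigr => i _.
  by rewrite /D; congr (Num.sqrt (1 + _ * _))^-1; apply: eq_bigl => j; rewrite mem_enum.
elim: s => [_|[i0 j0] s IH].
  rewrite /c big1 ?mul1r ?expr0 ?mul1e// => i _.
  by rewrite /D big_pred0// mulr0 addr0 sqrtr1 invr1.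
rewrite cons_uniq => /andP[i0s us].
rewrite {IH}(IH us).
set s' := (i0, j0) :: s.
pose U w := \sum_(j | (i0, j) \notin s') y j * X i0 j w.
pose V w := \sum_(i | i != i0) (- L s i * (\sum_(j | (i, j) \notin s) y j * X i j w) ^+ 2)
  + bet * \sum_(ij | ij \notin s') Y ij w ^+ 2.
have s'N i j : i != i0 -> ((i, j) \in s') = ((i, j) \in s).
  by move=> ii0; rewrite in_cons xpair_eqE (negbTE ii0).
have Es w : E s w = - L s i0 * (y j0 * Y (i0, j0) w + U w) ^+ 2
    + bet * Y (i0, j0) w ^+ 2 + V w.
  rewrite /E (bigD1 i0)//= (bigD1 j0)//= [in X in _ + bet * X](bigD1 (i0, j0))//=.
  rewrite /V /U /Y /= [X in _ * (_ + X) ^+ 2](_ : _ =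
      \sum_(j | (i0, j) \notin s') y j * X i0 j w).
    rewrite [X in bet * (_ + X)](_ : _ =
        \sum_(ij | ij \notin s') X ij.1 ij.2 w ^+ 2); first by ring.
    by apply: eq_bigl => ij; rewrite in_cons negb_or andbC.
  by apply: eq_bigl => j; rewrite in_cons xpair_eqE eqxx/= negb_or andbC.
have Es' w : E s' w = - L s' i0 * U w ^+ 2 + V w.
  rewrite /E (bigD1 i0)//= -addrA; congr (_ + (_ + _)).
  apply: eq_bigr => i ii0; congr (- _ * _ ^+ 2).
    by rewrite /L /D; congr (_ / (1 + _ * _)); apply: eq_bigl => j; rewrite s'N.
  by apply: eq_bigl => j; rewrite s'N.
under eq_integral do rewrite Es.
under [in RHS]eq_integral do rewrite Es'.
pose T' := g_sigma_algebraType (cylinders_avoiding Y (i0, j0)).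
have mY (ij : 'I_n * 'I_p) : ij \notin s' ->
    measurable_fun setT (Y ij : T' -> R).
  by rewrite in_cons negb_or => /andP[? _]; exact: measurable_fun_avoiding.
have mU : measurable_fun setT (U : T' -> R).
  apply: measurable_sum_cond => j ij; apply: measurable_funM => //.
  exact: (mY (i0, j)).
have mV : measurable_fun setT (V : T' -> R).
  apply: measurable_funD.
    apply: measurable_sum_cond => i ii0; apply: measurable_funM => //.
    apply: measurable_funX; apply: measurable_sum_cond => j ij.
    by apply: measurable_funM => //; apply: (mY (i, j)); rewrite s'N.
  apply: measurable_funM => //; apply: measurable_sum_cond => ij ijs.
  by apply: measurable_funX; exact: mY.
rewrite (@integral_gauss_step _ _ _ _ _ Y (i0, j0) _ _ _ _ (y j0)
  indX (XN i0 j0) mU mV (ltW (L0 s i0)) bet2) -/k.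
have DE : D s' i0 = D s i0 + 2 * lam / k * y j0 ^+ 2.
  rewrite /D (bigD1 j0) /=; last by rewrite in_cons eqxx.
  suff -> : \sum_(j | ((i0, j) \in s') && (j != j0)) y j ^+ 2 =
      \sum_(j | (i0, j) \in s) y j ^+ 2 by ring.
  apply: eq_bigl => j; rewrite in_cons xpair_eqE eqxx/=.
  by case: (eqVneq j j0) => [->|]/=; rewrite ?andbF ?andbT// (negbTE i0s).
have kE : k + 2 * L s i0 * y j0 ^+ 2 = k * D s' i0 / D s i0.
  by rewrite DE /L; field; rewrite !gt_eqF.
rewrite kE.
have -> : L s i0 * k / (k * D s' i0 / D s i0) = L s' i0.
  by rewrite /L; field; rewrite !gt_eqF.
rewrite muleA -EFinM; congr (_%:E * _)%E.
rewrite /c /= exprS (bigD1 i0)//= [in RHS](bigD1 i0)//=.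
rewrite [in RHS](eq_bigr (fun i => (Num.sqrt (D s i))^-1)); last first.
  move=> i ii0; rewrite /D; congr (Num.sqrt (1 + _ * _))^-1.
  by apply: eq_bigl => j; rewrite s'N.
rewrite sqrtrM ?mulr_ge0 ?ltW// sqrtrM ?ltW// sqrtrV ?ltW//.
by field; rewrite !gt_eqF ?sqrtr_gt0.
Qed.

(** * The smallest singular value as a minimal stretching factor *)

(** Over the complex numbers the matrix is Hermitian, hence unitarily similar to
    a real diagonal matrix. *)
Lemma symmetric_char_poly_split (R : rcfType) (p : nat) (M : 'M[R]_p) :
  M^T = M -> exists s : seq R, char_poly M = \prod_(a <- s) ('X - a%:P).
Proof.
move=> Msym; pose C := complex.complex R.
pose iota : {rmorphism R -> C} := complex.real_complex R.
pose MC := map_mx iota M.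
have iota_real a : iota a \is Num.real by apply/complex.complex_realP; exists a.
have MCherm : MC \is hermsymmx.
  apply: realsym_hermsym; last by apply/mxOverP => i j; rewrite mxE iota_real.
  by apply/is_hermitianmxP; rewrite expr0 scale1r map_mx_id// map_trmx Msym.
have /hermitian_normalmx/orthomx_spectralP eMC := MCherm.
have real_diag := hermitian_spectral_diag_real MCherm.
pose a i := complex.Re (spectral_diag MC 0 i).
have aE i : iota (a i) = spectral_diag MC 0 i.
  by rewrite /iota/= complex.RRe_real//; exact: (mxOverP real_diag).
exists [seq a i | i <- enum 'I_p].
apply: (map_poly_inj iota); rewrite map_char_poly -/MC.
set D := diag_mx _ in eMC; set Q := spectralmx MC in eMC.
have Qu : Q \in unitmx by exact: spectral_unit.
have -> : char_poly MC = char_poly D.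
  have QQ : map_mx polyC (invmx Q) *m map_mx polyC Q = 1%:M.
    by rewrite -map_mxM mulVmx// map_mx1.
  have cE : char_poly_mx MC =
      map_mx polyC (invmx Q) *m char_poly_mx D *m map_mx polyC Q.
    rewrite /char_poly_mx [in LHS]eMC !map_mxM/= mulmxBr mulmxBl; congr (_ - _).
    by rewrite scalar_mxC -mulmxA QQ mulmx1.
  by rewrite /char_poly cE !det_mulmx mulrAC -det_mulmx QQ det1 mul1r.
rewrite char_poly_trig ?diag_mx_is_trig//.
rewrite rmorph_prod big_map big_enum/=; apply: eq_bigr => i _.
by rewrite rmorphB/= map_polyX map_polyC/= aE mxE eqxx mulr1n.
Qed.

Lemma size_eigenvalues (R : realType) (p : nat) (M : 'M[R]_p) :
  M^T = M -> size (eigenvalues M) = p.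
Proof.
move=> /symmetric_char_poly_split[s es].
have ps : size s = p.
  by have := size_char_poly M; rewrite es size_prod_XsubC => -[].
rewrite -[RHS]ps -(perm_size (perm_count_undup s)) /eigenvalues.
apply: perm_size; apply: perm_flatten.
rewrite (eq_map (g := fun x => nseq (count_mem x s) x)); last first.
  by move=> x /=; rewrite es mu_prod_XsubC.
apply: perm_map; apply: uniq_perm; rewrite ?undup_uniq ?uniq_roots//.
move=> x; rewrite mem_undup -roots_on_rootsR ?es; last first.
  by rewrite monic_neq0// monic_prod_XsubC.
by rewrite in_itv/= root_prod_XsubC.
Qed.

Lemma eigenvalues_root (R : realType) (p : nat) (M : 'M[R]_p) x :
  x \in eigenvalues M -> eigenvalue M x.
Proof.
move=> /flattenP[_ /mapP[y yr ->]] /nseqP[-> _].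
rewrite eigenvalue_root_char; move: yr; rewrite -roots_on_rootsR => [/andP[]//|].
by rewrite monic_neq0// char_poly_monic.
Qed.

(** When [p <= n] the entry read off by [smin] is the square root of an
    eigenvalue [x] of [A^T *m A], because that matrix has exactly [p]
    eigenvalues; for an eigenvector [v], the squared norm of [A v] is then
    [x] times that of [v]. *)
Lemma smin_attained (R : realType) (n p : nat) (A : 'M[R]_(n, p)) :
  (0 < p)%N -> (p <= n)%N ->
  0 <= smin A /\ exists2 v : 'I_p -> R, 0 < \sum_j v j ^+ 2 &
    \sum_i (\sum_j v j * A i j) ^+ 2 = smin A ^+ 2 * \sum_j v j ^+ 2.
Proof.
move=> p0 pn.
have szs : size (singular_values A) = p.
  by rewrite size_sort size_map size_eigenvalues// trmx_mul trmxK.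
have : smin A \in singular_values A.
  by rewrite /smin; apply: mem_nth; rewrite szs (minn_idPr pn) prednK.
rewrite mem_sort => /mapP[x /eigenvalues_root/eigenvalueP[v vA v0] ->].
split; first exact: sqrtr_ge0.
have S0 : 0 < \sum_j v 0 j ^+ 2.
  rewrite lt_neqAle sumr_ge0 ?andbT//; last by move=> j _; exact: sqr_ge0.
  apply: contra_neq v0 => /esym/eqP; rewrite psumr_eq0//; last first.
    by move=> j _; exact: sqr_ge0.
  move=> /allP h; apply/rowP => j; rewrite mxE; apply/eqP.
  by have := h j (mem_index_enum j); rewrite /= sqrf_eq0.
exists (fun j => v 0 j) => //.
have vv : (v *m v^T) 0 0 = \sum_j v 0 j ^+ 2.
  by rewrite mxE; apply: eq_bigr => j _; rewrite mxE.
have Avv : \sum_i (\sum_j v 0 j * A i j) ^+ 2 = x * \sum_j v 0 j ^+ 2.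
  transitivity ((v *m (A^T *m A) *m v^T) 0 0); last first.
    by rewrite vA -scalemxAl mxE vv.
  have -> : v *m (A^T *m A) *m v^T = (v *m A^T) *m (v *m A^T)^T.
    by rewrite trmx_mul trmxK !mulmxA.
  rewrite mxE; apply: eq_bigr => i _; rewrite [_^T _ _]mxE -expr2.
  by congr (_ ^+ 2); rewrite mxE; apply: eq_bigr => j _; rewrite mxE.
rewrite Avv sqr_sqrtr// -(pmulr_lge0 x S0) -Avv.
by apply: sumr_ge0 => i _; exact: sqr_ge0.
Qed.

(** * A net adapted to the quadratic form *)

Lemma bin_le_exp2 (n m : nat) : ('C(n, m) <= 2 ^ n)%N.
Proof.
elim: n m => [|n IH] [|m] //; first by rewrite bin0 expn_gt0.
by rewrite binS expnS mul2n -addnn leq_add.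
Qed.

(** The squared Euclidean norm of [A y]. *)
Definition normsq_comb (R : realType) n p (A : 'M[R]_(n, p)) (y : 'I_p -> R) : R :=
  \sum_i (\sum_j y j * A i j) ^+ 2.

(** Scaled to squared norm [p], the vector has a coordinate of modulus at least 1.
    Scaling the vector so as to round that modulus up to an integer takes a
    factor between 1 and 2. *)
Lemma rescale_integral_coordinate (R : realType) p (v : 'I_p -> R) :
  0 < \sum_j v j ^+ 2 ->
  exists (c : R) (j : 'I_p), [/\ exists z : int, c * v j = z%:~R,
    p%:R <= c ^+ 2 * \sum_j v j ^+ 2 & c ^+ 2 * \sum_j v j ^+ 2 <= 4 * p%:R].
Proof.
set S := \sum_j _ => S0.
have p0 : (0 < p)%N.
  by case: p v @S S0 => // v; rewrite /= big_ord0 ltxx.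
pose c0 := Num.sqrt (p%:R / S).
have pS0 : 0 < p%:R / S by rewrite divr_gt0// ltr0n.
have c02 : c0 ^+ 2 * S = p%:R.
  by rewrite sqr_sqrtr ?ltW// divfK// gt_eqF.
have [j vj] : exists j, 1 <= `|c0 * v j|.
  apply: contrapT => /forallNP h.
  suff : c0 ^+ 2 * S < p%:R by rewrite c02 ltxx.
  rewrite mulr_sumr -[p in ltRHS]card_ord -sumr_const.
  apply: ltr_sum; first by apply/hasP; exists (Ordinal p0); rewrite ?mem_index_enum.
  move=> j _; rewrite -exprMn -real_normK ?num_real// expr_lt1//.
  by have /negP := h j; rewrite -ltNge.
set a := `|c0 * v j| in vj.
have a0 : 0 < a by exact: lt_le_trans vj.
have /andP[ta at1] := truncn_itv (ltW a0).
set t := Num.truncn a in ta at1.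
exists (t.+1%:R / a * c0), j; split.
- have -> : t.+1%:R / a * c0 * v j = t.+1%:R * ((c0 * v j) / a) by ring.
  rewrite /a; have [s0|s0] := lerP 0 (c0 * v j).
    by exists t.+1%:Z; rewrite ger0_norm// divff ?mulr1// -normr_eq0 gt_eqF.
  exists (- t.+1%:Z); rewrite ltr0_norm// invrN mulrN divff ?mulrN1 ?intrN//.
  by rewrite -normr_eq0 gt_eqF.
- rewrite exprMn -mulrA c02 ler_peMl// exprn_ege1// ler_pdivlMr// mul1r ltW//.
- rewrite exprMn -mulrA c02 ler_wpM2r//.
  have -> : 4 = 2 ^+ 2 :> R by rewrite -natrX.
  apply: lerXn2r; rewrite ?nnegrE ?divr_ge0 ?(ltW a0)//.
  by rewrite ler_pdivrMr// -natr1 mulr_natl mulr2n lerD.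
Qed.

(** As a function of one coordinate, the squared norm of [A y] is quadratic with
    leading coefficient the squared norm of a column. Of the two neighbouring
    multiples of [1 / L], one makes the linear term nonpositive; with that choice
    the errors of successive roundings add up only through the quadratic
    terms. *)
Lemma round_coordinates (R : realType) n p (A : 'M[R]_(n, p)) (L : nat)
    (w : 'I_p -> R) (s : seq 'I_p) : (0 < L)%N -> uniq s ->
  exists y : 'I_p -> R,
    [/\ forall i, i \notin s -> y i = w i,
        forall i, i \in s -> exists z : int, y i = z%:~R / L%:R,
        forall i, (y i - w i) ^+ 2 <= L%:R ^- 2 &
        normsq_comb A y <=
          normsq_comb A w + (\sum_(i <- s) \sum_k A k i ^+ 2) / L%:R ^+ 2].
Proof.
move=> L0; have LR0 : 0 < L%:R :> R by rewrite ltr0n.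
elim: s => [_|a s IH /= /andP[as_ us]].
  exists w; split => //; first by move=> i; rewrite subrr expr0n invr_ge0 sqr_ge0.
  by rewrite big_nil mul0r addr0.
have [y [y1 y2 y3 y4]] := IH us.
pose b := \sum_k (\sum_j y j * A k j) * A k a.
pose N := \sum_k A k a ^+ 2.
pose upd t := fun i => if i == a then t else y i.
have updE t : normsq_comb A (upd t) =
    normsq_comb A y + 2 * (t - y a) * b + (t - y a) ^+ 2 * N.
  rewrite /normsq_comb /b /N mulr_sumr [X in _ + X]mulr_sumr -!big_split/=.
  apply: eq_bigr => k _.
  have -> : \sum_j upd t j * A k j = \sum_j y j * A k j + (t - y a) * A k a.
    rewrite (bigD1 a)//= [in RHS](bigD1 a)//= /upd eqxx.
    rewrite (eq_bigr (fun j => y j * A k j)); last by move=> j /negbTE->.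
    by ring.
  by ring.
(* The choice between the two neighbours depends on the sign of the slope b. *)
have [t [[z tz] tb t2]] : exists t, [/\ exists z : int, t = z%:~R / L%:R,
    (t - y a) * b <= 0 & (t - y a) ^+ 2 <= L%:R ^- 2].
  have /andP[fl fu] := floor_itv (L%:R * y a).
  set f := Num.floor _ in fl fu.
  have fl' : f%:~R / L%:R <= y a by rewrite ler_pdivrMr// mulrC.
  have fu' : y a <= (f + 1)%:~R / L%:R by rewrite ler_pdivlMr// mulrC ltW.
  have fD : (f + 1)%:~R / L%:R = f%:~R / L%:R + L%:R^-1 :> R.
    by rewrite intrD mulrDl mul1r.
  have Li0 : 0 < L%:R^-1 :> R by rewrite invr_gt0.
  have [b0|b0] := lerP 0 b.
    exists (f%:~R / L%:R); split; first by exists f.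
      by rewrite mulr_le0_ge0// subr_le0.
    by rewrite -exprVn; rewrite fD in fu'; nra.
  exists ((f + 1)%:~R / L%:R); split; first by exists (f + 1).
    by rewrite mulr_ge0_le0 ?subr_ge0// ltW.
  by rewrite -exprVn; rewrite fD in fu' *; nra.
exists (upd t); split.
- move=> i; rewrite in_cons negb_or => /andP[/negbTE ia is_]; rewrite /upd ia; exact: y1.
- move=> i; rewrite in_cons /upd; case: eqVneq => [_ _|_ /= /y2//]; by exists z.
- by move=> i; rewrite /upd; case: eqVneq => [->|_]; rewrite -?(y1 _ as_).
- rewrite updE big_cons mulrDl.
  have N0 : 0 <= N by apply: sumr_ge0 => k _; exact: sqr_ge0.
  have : (t - y a) ^+ 2 * N <= N / L%:R ^+ 2 by rewrite mulrC ler_wpM2l.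
  rewrite -/N; move: y4 tb.
  set Q := normsq_comb A y; set W := normsq_comb A w; lra.
Qed.

(** A net point is coded by the index of its integral coordinate, the signs, the
    integral parts of the moduli and, at the other coordinates, the fractional
    parts in units of [1 / L]. Bounding the sum of the integral parts by [M]
    leaves, for [M] linear in [p], at most exponentially many codes times
    [L ^ p], where [p.+1] is the dimension. *)
Definition net_code (p L M : nat) : finType :=
  ('I_p.+1 * {ffun 'I_p.+1 -> bool} * p.+1.-tuple 'I_M.+1 * {ffun 'I_p -> 'I_L})%type.

Definition net_point (R : realType) (p L M : nat) (x : net_code p L M) :
    {ffun 'I_p.+1 -> R} :=
  let: (j, sg, k, rho) := x in
  [ffun i => (-1) ^+ sg i * ((tnth k i)%:R +
     (if unlift j i is Some i' then (rho i' : nat)%:R else 0) / L%:R)].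

Definition net_codes (p L M : nat) : {set net_code p L M} :=
  [set x : net_code p L M | (\sum_(i <- x.1.2) i <= M)%N].

Lemma card_net_codes (p L M : nat) :
  #|net_codes p L M| = (p.+1 * 2 ^ p.+1 * 'C(p.+1 + M, p.+1) * L ^ p)%N.
Proof.
rewrite (_ : net_codes p L M = finset.setX (finset.setX finset.setT
   [set t : p.+1.-tuple 'I_M.+1 | (\sum_(i <- t) i <= M)%N]) finset.setT).
  rewrite !cardsX card_partial_ord_partitions !cardsT card_prod card_ord.
  by rewrite !card_ffun card_bool !card_ord.
by apply/finset.setP => -[[[j sg] k] rho]; rewrite !inE /= andbT.
Qed.

(** An integral part [k] satisfies [k <= k ^ 2 <= y i ^+ 2], so a bound on the
    squared norm bounds the sum of the integral parts. *)
Lemma net_point_surj (R : realType) (p L M : nat) (j : 'I_p.+1)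
    (y : 'I_p.+1 -> R) : (0 < L)%N ->
  (exists z : int, y j = z%:~R) ->
  (forall i, i != j -> exists z : int, y i = z%:~R / L%:R) ->
  \sum_i y i ^+ 2 <= M%:R ->
  exists2 x : net_code p L M, x \in net_codes p L M & forall i, net_point R x i = y i.
Proof.
move=> L0 [zj yj] yi yM.
have LR : L%:R != 0 :> R by rewrite pnatr_eq0 -lt0n.
have [z zE] : {z : 'I_p.+1 -> int & forall i, y i = (z i)%:~R / L%:R}.
  apply: (@boolp.choice _ _ (fun i (m : int) => y i = m%:~R / L%:R)) => i.
  have [->|/yi//] := eqVneq i j.
  by exists (zj * L%:Z); rewrite yj intrM mulfK.
have zL : (L %| `|z j|)%N.
  have : (z j)%:~R = (zj * L%:Z)%:~R :> R by rewrite intrM -yj zE divfK.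
  by move=> /intr_inj ->; rewrite abszM dvdn_mull.
pose k i := (`|z i| %/ L)%N.
have kle i : (k i)%:R <= y i ^+ 2.
  have h : (k i)%:R <= `|y i|.
    rewrite zE normrM normfV normr_nat ler_pdivlMr ?ltr0n// -natrM.
    by rewrite -intr_norm -abszE -pmulrn ler_nat leq_trunc_div.
  rewrite -real_normK ?num_real//; apply: le_trans (_ : (k i)%:R ^+ 2 <= _).
    by rewrite -natrX ler_nat; case: (k i) => // m; rewrite expnS expn1 leq_pmulr.
  by rewrite lerXn2r ?nnegrE.
have sk : (\sum_i k i <= M)%N.
  rewrite -(ler_nat R) natr_sum; apply: le_trans yM; exact: ler_sum.
have kM i : (k i < M.+1)%N.
  by rewrite ltnS; apply: leq_trans sk; rewrite (bigD1 i)//= leq_addr.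
pose kt := [tuple Ordinal (kM i) | i < p.+1].
pose rho := [ffun i' : 'I_p => Ordinal (ltn_pmod `|z (lift j i')|%N L0)].
pose sg := [ffun i : 'I_p.+1 => z i < 0].
exists (j, sg, kt, rho).
  by rewrite inE /= big_map big_enum.
move=> i; rewrite ffunE tnth_mktuple ffunE /=.
have -> : (if unlift j i is Some i' then (rho i' : nat)%:R else 0) =
    (`|z i| %% L)%:R :> R.
  case: unliftP => [i' ->|->]; first by rewrite ffunE.
  by move/eqP: zL => ->.
have -> : (k i)%:R + (`|z i| %% L)%:R / L%:R = `|z i|%:R / L%:R :> R.
  rewrite [in RHS](divn_eq `|z i| L) natrD natrM mulrDl mulfK//.
rewrite zE mulrA; congr (_ / _).
have [z0|z0] := ltrP (z i) 0.
  by rewrite expr1 mulN1r pmulrn abszE ltr0_norm// intrN opprK.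
by rewrite expr0 mul1r pmulrn abszE ger0_norm.
Qed.

(** The lower bound on the norm of [y] makes it unlikely that a random [A] maps
    [y] to a short vector, and the exponent [p.-1] of [L] is the source of the
    exact exponent in the small-ball estimate. *)
Lemma net_exists (R : realType) (p L : nat) : (0 < p)%N -> (1 < L)%N ->
  exists N : seq {ffun 'I_p -> R},
    [/\ (size N <= 2 ^ (12 * p) * L ^ p.-1)%N,
        forall y, y \in N -> p%:R / 4 <= \sum_j y j ^+ 2 &
        forall n (A : 'M[R]_(n, p)), (p <= n)%N ->
          exists2 y, y \in N & normsq_comb A y <=
             4 * p%:R * smin A ^+ 2 + (\sum_i \sum_j A i j ^+ 2) / L%:R ^+ 2].
Proof.
case: p => // p _ L1; have L0 : (0 < L)%N by exact: ltnW.
pose q := p.+1; pose M := (9 * q)%N.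
(* The rescaled vector has squared norm at most 4 q, and rounding with step at
   most 1/2 brings it to at most 9 q. *)
pose good (x : net_code p L M) :=
  (x \in net_codes p L M) && (q%:R / 4 <= \sum_j net_point R x j ^+ 2).
exists [seq net_point R x | x <- enum good]; split.
- rewrite size_map -cardE.
  apply: (@leq_trans #|net_codes p L M|).
    by apply: subset_leq_card; apply/fintype.subsetP => x /andP[].
  rewrite card_net_codes leq_mul2r; apply/orP; right.
  apply: (@leq_trans (2 ^ q * 2 ^ q * 2 ^ (q + M))).
    by rewrite leq_mul ?bin_le_exp2// leq_mul2r ltnW ?orbT// ltn_expl.
  by rewrite -!expnD leq_exp2l// /M; lia.
- by move=> y /mapP[x]; rewrite mem_enum => /andP[_ ?] ->.
move=> n A pn; have [_ [v v0 vA]] := smin_attained A (ltn0Sn p) pn.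
have [c [j [[z cz] cl cu]]] := rescale_integral_coordinate v0.
pose w i := c * v i.
have wS : \sum_i w i ^+ 2 = c ^+ 2 * \sum_i v i ^+ 2.
  by rewrite mulr_sumr; apply: eq_bigr => i _; rewrite exprMn.
have wA : normsq_comb A w = smin A ^+ 2 * \sum_i w i ^+ 2.
  rewrite wS mulrCA -vA /normsq_comb mulr_sumr; apply: eq_bigr => i _.
  by rewrite -exprMn mulr_sumr; congr (_ ^+ 2); apply: eq_bigr => l _; rewrite mulrA.
rewrite -wS in cl cu.
pose s := [seq i <- enum 'I_p.+1 | i != j].
have us : uniq s by rewrite filter_uniq// enum_uniq.
have sE i : (i \in s) = (i != j) by rewrite mem_filter mem_enum andbT.
have [y [y1 y2 y3 y4]] := round_coordinates A w L0 us.
have LR : 0 < L%:R :> R by rewrite ltr0n.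
have L2 : L%:R ^- 2 <= 4^-1 :> R.
  by rewrite lef_pV2 ?posrE ?exprn_gt0// -natrX ler_nat (@leq_exp2r 2 L 2).
have yl i : w i ^+ 2 / 2 - 4^-1 <= y i ^+ 2.
  by have := y3 i; have := sqr_ge0 (y i - w i); have := sqr_ge0 (2 * y i - w i); nra.
have yu i : y i ^+ 2 <= 2 * w i ^+ 2 + 2^-1.
  by have := y3 i; have := sqr_ge0 (y i - 2 * w i); nra.
have yL : q%:R / 4 <= \sum_i y i ^+ 2.
  apply: (le_trans _ (ler_sum _ (fun i _ => yl i))).
  rewrite big_split/= -mulr_suml sumr_const card_ord -mulr_natl.
  move: cl; rewrite -/q; set W := \sum_i _; lra.
have yU : \sum_i y i ^+ 2 <= M%:R.
  apply: (le_trans (ler_sum _ (fun i _ => yu i))).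
  rewrite big_split/= -mulr_sumr sumr_const card_ord -mulr_natl /M natrM.
  move: cu; rewrite -/q; set W := \sum_i _.
  have : 0 <= q%:R :> R by [].
  lra.
have [] := @net_point_surj R p L M j y L0 _ _ yU.
- by exists z; rewrite y1 ?sE ?eqxx.
- by move=> i ij; apply: y2; rewrite sE.
move=> x xN xy; exists (net_point R x).
  apply/mapP; exists x => //; rewrite mem_enum; apply/andP; split => //.
  by under eq_bigr do rewrite xy.
have -> : normsq_comb A (net_point R x) = normsq_comb A y.
  by apply: eq_bigr => i _; under eq_bigr do rewrite xy.
apply: (le_trans y4); rewrite wA lerD//.
  by rewrite mulrC ler_wpM2r// sqr_ge0.
rewrite ler_wpM2r ?invr_ge0 ?sqr_ge0//.
rewrite [in leRHS]exchange_big/= big_filter big_enum_cond/=.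
rewrite [leRHS](bigD1 j)//= lerDr.
by apply: sumr_ge0 => i _; exact: sqr_ge0.
Qed.

(** * The small-ball estimate at one scale *)

Lemma bernoulli_ineq (R : realDomainType) (x : R) n :
  0 <= x <= 1 -> 1 - n%:R * x <= (1 - x) ^+ n.
Proof.
move=> /andP[x0 x1]; elim: n => [|n IH]; first by rewrite mul0r subr0 expr0.
rewrite exprS; apply: le_trans (ler_wpM2l _ IH); last by rewrite subr_ge0.
by rewrite -natr1; have : 0 <= n%:R :> R by []; nra.
Qed.

(** The contribution of one row to the expectation at a net point of squared norm
    [S]. The power of [1 - 2 * (16 * p%:R)^-1] stays away from zero by
    Bernoulli's inequality, and the last square root is at least [L / 6]. *)
Lemma gauss_factor_le (R : realType) (p L : nat) (S : R) :
  (0 < p)%N -> (1 < L)%N -> p%:R / 4 <= S ->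
  expR 4^-1 * ((Num.sqrt (1 - 2 * (16 * p%:R)^-1))^-1 ^+ p *
    (Num.sqrt (1 + 2 * (L%:R ^+ 2 / (16 * p%:R)) /
      (1 - 2 * (16 * p%:R)^-1) * S))^-1) <= 16 / L%:R.
Proof.
move=> p0 L1 pS; set bet := (16 * p%:R)^-1; set lam := L%:R ^+ 2 / (16 * p%:R).
set k := 1 - 2 * bet.
have pR : 1 <= p%:R :> R by rewrite ler1n.
have LR : 0 < L%:R :> R by rewrite ltr0n ltnW.
have bE : 2 * bet = (8 * p%:R)^-1 by rewrite /bet; field; lra.
have b0 : 0 < (8 * p%:R)^-1 :> R by rewrite invr_gt0; lra.
have b8 : (8 * p%:R)^-1 <= 8^-1 :> R by rewrite lef_pV2 ?posrE; lra.
have k0 : 0 < k by rewrite /k bE; lra.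
have k1 : k <= 1 by rewrite /k bE; lra.
have e1 : expR 4^-1 <= 4 / 3 :> R.
  have := expR_ge1Dx (- 4^-1 : R); rewrite expRN => h.
  rewrite -[expR _]invrK -[4 / 3]invrK lef_pV2 ?posrE ?invr_gt0 ?expR_gt0; lra.
have e2 : (Num.sqrt k)^-1 ^+ p <= 2.
  rewrite exprVn -[2]invrK lef_pV2 ?posrE ?exprn_gt0 ?sqrtr_gt0 ?invr_gt0//.
  have kp : 4^-1 <= k ^+ p.
    apply: le_trans (bernoulli_ineq p _); last by rewrite bE; lra.
    by rewrite bE (_ : p%:R * (8 * p%:R)^-1 = 8^-1); [lra | field; lra].
  have h : (2^-1) ^+ 2 <= (Num.sqrt k ^+ p) ^+ 2.
    by rewrite exprAC sqr_sqrtr ?(ltW k0)//; apply: le_trans kp; lra.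
  by rewrite -(@ler_pXn2r _ 2) ?nnegrE ?exprn_ge0 ?sqrtr_ge0//; lra.
have e3 : (Num.sqrt (1 + 2 * lam / k * S))^-1 <= 6 / L%:R.
  have S0 : 0 <= S by apply: le_trans pS; lra.
  (* 6 is chosen with 6^2 >= 32, where 2 lam (p / 4) = L^2 / 32. *)
  have hL : (L%:R / 6) ^+ 2 <= 1 + 2 * lam / k * S.
    have l0 : 0 <= 2 * lam by rewrite /lam mulr_ge0// divr_ge0 ?sqr_ge0//; lra.
    have h1 : 2 * lam * (p%:R / 4) <= 2 * lam / k * S.
      rewrite -[2 * lam / k * S]mulrA ler_wpM2l//; apply: le_trans pS _.
      by rewrite mulrC ler_pdivlMr// ler_piMr.
    have h2 : 2 * lam * (p%:R / 4) = L%:R ^+ 2 / 32 by rewrite /lam; field; lra.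
    rewrite h2 in h1; have := sqr_ge0 (L%:R : R); rewrite exprMn exprVn; lra.
  have -> : 6 / L%:R = (L%:R / 6)^-1 :> R by rewrite invfM invrK mulrC.
  rewrite lef_pV2 ?posrE ?divr_gt0// ?sqrtr_gt0.
    by rewrite -[X in X <= _]ger0_norm ?divr_ge0// -sqrtr_sqr ler_wsqrtr.
  by apply: lt_le_trans hL; rewrite exprn_gt0// divr_gt0.
apply: (le_trans (ler_pM _ _ e1 (ler_pM _ _ e2 e3))).
all: rewrite ?expR_ge0 ?mulr_ge0 ?exprn_ge0 ?invr_ge0 ?sqrtr_ge0//.
by rewrite !mulrA; lra.
Qed.

(** The majorant [g] dominates the indicator of the event that [smin] is at most
    [sqrt n / L]: on that event the term of one well-chosen net point is already
    at least 1. *)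
Lemma single_scale_majorant d (T : measurableType d) (R : realType)
    (P : probability T R) (n p L : nat) (X : 'I_n -> 'I_p -> {RV P >-> R}) :
  (0 < p)%N -> (p <= n)%N -> (1 < L)%N -> iid_standard_normal X ->
  exists g : T -> \bar R,
    [/\ measurable_fun setT g, forall w, (0 <= g w)%E,
        forall w, smin (random_matrix X w) ^+ 2 <= n%:R / L%:R ^+ 2 -> (1 <= g w)%E &
        (\int[P]_w g w <= (2 ^+ (16 * n) / L%:R ^+ (n - p.-1))%:E)%E].
Proof.
move=> p0 pn L1 iidX.
have [N [sN yN cover]] := net_exists R p0 L1.
have pR : 1 <= p%:R :> R by rewrite ler1n.
have LR : 0 < L%:R :> R by rewrite ltr0n ltnW.
(* With these coefficients, lam times the bound of the net on |A y|^2 is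
   n / 4 + bet |A|_F^2 when smin(A) = sqrt n / L. *)
pose bet : R := (16 * p%:R)^-1; pose lam : R := L%:R ^+ 2 / (16 * p%:R).
have lam0 : 0 < lam by rewrite divr_gt0 ?exprn_gt0//; lra.
have bet2 : bet < 2^-1 by rewrite /bet ltf_pV2 ?posrE; lra.
pose E (y : 'I_p -> R) w := \sum_i (- lam * (\sum_j y j * X i j w) ^+ 2)
      + bet * \sum_i \sum_j X i j w ^+ 2.
pose g w := (\sum_(y <- N) (expR (n%:R / 4))%:E * (expR (E y w))%:E)%E.
have mE (y : {ffun 'I_p -> R}) : measurable_fun setT (fun w => (expR (E y w))%:E).
  apply/measurable_EFinP; apply: measurableT_comp => //.
  apply: measurable_funD; last first.
    apply: measurable_funM => //; apply: measurable_sum => i.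
    by apply: measurable_sum => j; exact: measurable_funX.
  apply: measurable_sum => i; apply: measurable_funM => //.
  apply: measurable_funX; apply: measurable_sum => j.
  exact: measurable_funM.
have mg (y : {ffun 'I_p -> R}) :
    measurable_fun setT (fun w => (expR (n%:R / 4))%:E * (expR (E y w))%:E)%E.
  exact: measurable_funeM.
have g0 (y : {ffun 'I_p -> R}) w : (0 <= (expR (n%:R / 4))%:E * (expR (E y w))%:E)%E.
  by rewrite mule_ge0// lee_fin expR_ge0.
exists g; split.
- apply: (@emeasurable_sum _ _ _ _ _ _ (fun (y : {ffun _ -> R}) w =>
    (expR (n%:R / 4))%:E * (expR (E y w))%:E)%E) => y.
  exact: mg.
- by move=> w; rewrite /g; apply: sume_ge0.
- move=> w; set A := random_matrix X w => As.
  have [y yNy yA] := cover _ A pn.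
  rewrite /g (big_rem y)//=.
  apply: (@le_trans _ _ ((expR (n%:R / 4))%:E * (expR (E y w))%:E)%E).
    rewrite -EFinM -expRD lee_fin -[leLHS]expR0 ler_expR.
    have -> : E y w = - lam * normsq_comb A y + bet * \sum_i \sum_j A i j ^+ 2.
      rewrite /E /normsq_comb [in RHS]mulr_sumr; congr (_ + _ * _).
        apply: eq_bigr => i _; congr (_ * _ ^+ 2).
        by apply: eq_bigr => j _; rewrite mxE.
      by apply: eq_bigr => i _; apply: eq_bigr => j _; rewrite mxE.
    move: yA; set F := \sum_i \sum_j _; set q := normsq_comb A y => yA.
    have : lam * q <= lam * (4 * p%:R * (n%:R / L%:R ^+ 2) + F / L%:R ^+ 2).
      rewrite ler_pM2l//; apply: le_trans yA _; rewrite lerD2r ler_wpM2l//; lra.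
    have -> : lam * (4 * p%:R * (n%:R / L%:R ^+ 2) + F / L%:R ^+ 2) =
        n%:R / 4 + bet * F.
      by rewrite /lam /bet; field; rewrite !gt_eqF//; lra.
    by rewrite mulNr; lra.
  by rewrite leeDl// sume_ge0.
rewrite /g ge0_integral_sum//.
pose B : R := (16 / L%:R) ^+ n.
apply: (@le_trans _ _ (\sum_(y <- N) B%:E)%E).
  rewrite big_seq [leRHS]big_seq; apply: lee_sum => y /yN yS.
  rewrite ge0_integralZl; first last.
  - by rewrite lee_fin expR_ge0.
  - by move=> w _; rewrite lee_fin expR_ge0.
  - exact: mE.
  - exact: measurableT.
  rewrite (integral_gauss_matrix y iidX lam0 bet2) -EFinM lee_fin /B.
  rewrite (mulnC n p) exprM -exprMn.
  have -> : expR (n%:R / 4) = expR 4^-1 ^+ n :> R by rewrite -expRM_natl.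
  rewrite -exprMn; apply: lerXn2r; last exact: gauss_factor_le.
    by rewrite nnegrE !mulr_ge0 ?expR_ge0 ?exprn_ge0 ?invr_ge0 ?sqrtr_ge0.
  by rewrite nnegrE divr_ge0 ?ltW.
rewrite sumEFin lee_fin big_const_seq count_predT iter_addr_0 -[B *+ _]mulr_natl.
have B0 : 0 <= B by rewrite exprn_ge0// divr_ge0// ltW.
apply: (@le_trans _ _ ((2 ^ (12 * p) * L ^ p.-1)%:R * B)).
  by rewrite ler_wpM2r// ler_nat.
rewrite natrM !natrX /B expr_div_n.
have -> : (16 : R) = 2 ^+ 4 by rewrite -natrX.
rewrite -exprM.
have -> : L%:R ^+ n = L%:R ^+ p.-1 * L%:R ^+ (n - p.-1) :> R.
  by rewrite -exprD subnKC//; lia.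
have -> : 2 ^+ (12 * p) * L%:R ^+ p.-1 *
    (2 ^+ (4 * n) / (L%:R ^+ p.-1 * L%:R ^+ (n - p.-1)))
   = 2 ^+ (12 * p + 4 * n) / L%:R ^+ (n - p.-1) :> R.
  by rewrite exprD; field; rewrite ?gt_eqF ?exprn_gt0.
rewrite ler_wpM2r ?invr_ge0 ?exprn_ge0 ?(ltW LR)//.
by rewrite ler_eXn2l ?ltr1n//; lia.
Qed.

(** * Summation over dyadic scales *)

Lemma nneseries_ge1_pinfty (R : realType) (u : nat -> \bar R) :
  (forall i, 1 <= u i)%E -> (\sum_(i <oo) u i = +oo)%E.
Proof.
move=> u1; have u0 i : (0 <= u i)%E by apply: le_trans (u1 i).
have lb k : (k%:R%:E <= \sum_(i <oo) u i)%E.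
  apply: le_trans (nneseries_lim_ge k _); last by move=> i _ _; exact: u0.
  rewrite big_mkord -[k in leLHS]card_ord -sumr_const -sumEFin.
  by apply: lee_sum => i _; exact: u1.
have : (0 <= \sum_(i <oo) u i)%E by exact: nneseries_ge0.
case: (\sum_(i <oo) u i)%E lb => [s lb|//|//]; rewrite lee_fin => s0.
have := lb (Num.truncn s).+1; rewrite lee_fin leNgt.
by have /andP[_ ->] := truncn_itv s0.
Qed.

Lemma nneseries_geometric_le (R : realType) (b q : R) : 0 <= b -> 0 <= q < 1 ->
  (\sum_(i <oo) (b * q ^+ i)%:E <= (b / (1 - q))%:E)%E.
Proof.
move=> b0 /andP[q0 q1]; apply: lime_le.
  by apply: is_cvg_nneseries => i _ _; rewrite lee_fin mulr_ge0// exprn_ge0.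
apply: nearW => k; rewrite sumEFin lee_fin.
have -> : \sum_(0 <= i < k) b * q ^+ i = b * (1 - q ^+ k) / (1 - q).
  rewrite big_mkord -mulr_sumr -!mulrA; congr (_ * _).
  apply: (canRL (mulfK _)); first by rewrite subr_eq0 gt_eqF.
  by rewrite -opprB mulrN mulrC -subrX1 opprB.
rewrite ler_wpM2r ?invr_ge0 ?subr_ge0 ?(ltW q1)// ler_piMr//.
by rewrite gerBl exprn_ge0.
Qed.

Lemma powR_exprn (R : realType) (x r : R) (i : nat) :
  0 <= x -> (x ^+ i) `^ r = (x `^ r) ^+ i.
Proof.
move=> x0; rewrite -(powR_mulrn i x0) -(powR_mulrn i (powR_ge0 x r)).
by rewrite -!powRrM mulrC.
Qed.

(** Let [l] be the least scale beyond [l0] with [b / 2 ^+ l < sg]. If [l] is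
    [l0], the constant term suffices; otherwise the previous scale has [G] at
    least 1. When [sg] is zero there is no such scale, all the [G i] are at least
    1 and the series is infinite. *)
Lemma dyadic_majorant (R : realType) (a b sg r : R) (l0 : nat) (G : nat -> \bar R) :
  0 < a -> 0 < b -> 0 <= sg -> 0 <= r -> (forall i, 0 <= G i)%E ->
  (forall i, sg <= b / 2 ^+ (l0 + i) -> (1 <= G i)%E) ->
  ((a%:E / sg%:E) `^ r <= ((a / b) `^ r)%:E *
     (((2 ^+ l0) `^ r)%:E + \sum_(i <oo) ((2 ^+ (l0 + i.+1)) `^ r)%:E * G i))%E.
Proof.
move=> a0 b0; rewrite le_eqVlt => /predU1P[<-|sg0] r0 G0 G1.
  rewrite nneseries_ge1_pinfty.
    by rewrite addey// gt0_muley ?leey// lte_fin powR_gt0// divr_gt0.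
  move=> i; rewrite -[1%E]mule1; apply: lee_pmul => //.
    rewrite lee_fin -[leLHS](powRr0 (2 ^+ (l0 + i.+1))); apply: ler_powR => //.
    by rewrite exprn_ege1// ler1n.
  by apply: G1; rewrite divr_ge0 ?exprn_ge0 ?ltW.
have t0 i : (0 <= ((2 ^+ (l0 + i.+1)) `^ r)%:E * G i)%E.
  by rewrite mule_ge0// lee_fin powR_ge0.
have key l : b / 2 ^+ l < sg ->
    ((a%:E / sg%:E) `^ r <= ((a / b) `^ r)%:E * ((2 ^+ l) `^ r)%:E)%E.
  move=> bl; rewrite inver gt_eqF// -EFinM poweR_EFin -EFinM lee_fin.
  have ab0 : 0 <= a / b by rewrite divr_ge0 ?ltW.
  have l2 : 0 < 2 ^+ l :> R by rewrite exprn_gt0.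
  rewrite -powRM ?(ltW l2)//; apply: ge0_ler_powR => //.
  - by rewrite nnegrE divr_ge0 ?ltW.
  - by rewrite nnegrE mulr_ge0// ltW.
  have h : 1 <= 2 ^+ l * sg / b.
    by rewrite ler_pdivlMr// mul1r mulrC -ler_pdivrMr// ltW.
  rewrite ler_pdivrMr// (_ : a / b * 2 ^+ l * sg = a * (2 ^+ l * sg / b)); last by ring.
  by rewrite ler_peMr// ltW.
have exl : exists l, b / 2 ^+ (l0 + l) < sg.
  have bs0 : 0 <= b / sg by rewrite divr_ge0 ?ltW.
  exists (Num.truncn (b / sg)).+1.
  rewrite ltr_pdivrMr ?exprn_gt0// mulrC -ltr_pdivrMr//.
  have /andP[_ h] := truncn_itv bs0; apply: lt_le_trans h _.
  rewrite -natrX ler_nat; apply: ltnW; apply: leq_trans (ltn_expl _ (ltnSn 1)) _.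
  by rewrite leq_exp2l// leq_addl.
have [l bl lmin] := ex_minnP exl.
apply: le_trans (key _ bl) _; apply: lee_wpmul2l; first by rewrite lee_fin powR_ge0.
case: l bl lmin => [|i] bl lmin.
  by rewrite addn0 leeDl// nneseries_ge0.
have Gi : (1 <= G i)%E.
  apply: G1; rewrite leNgt; apply/negP => /lmin; by rewrite ltnn.
apply: (@le_trans _ _ (\sum_(i <oo) ((2 ^+ (l0 + i.+1)) `^ r)%:E * G i)%E); last first.
  by rewrite leeDr// lee_fin powR_ge0.
apply: le_trans (nneseries_lim_ge i.+1 _); last by move=> k _ _; exact: t0.
rewrite big_nat_recr//=; apply: (@le_trans _ _ (((2 ^+ (l0 + i.+1)) `^ r)%:E * G i)%E).
  by rewrite -[leLHS]mule1; apply: lee_wpmul2l => //; rewrite lee_fin powR_ge0.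
by rewrite leeDr// sume_ge0.
Qed.

(** * Negative moments of the smallest singular value *)

(** The numerator [a] is kept arbitrary because the factor
    [(a / sqrt n) `^ r] has to be taken out of a measurable majorant rather than
    out of the integral of the quotient. *)
Lemma smin_neg_moment_le (R : realType) (r g0 : R) : 0 <= r -> 0 < g0 < 1 ->
  exists2 K : R, 0 < K & forall n p : nat,
    (0 < p)%N -> p%:R + r - 1 < n%:R -> p%:R / n%:R <= g0 ->
    forall (d : measure_display) (T : measurableType d) (P : probability T R)
      (X : 'I_n -> 'I_p -> {RV P >-> R}) (a : R), 0 < a ->
    iid_standard_normal X ->
    (smin_neg_moment X a r <= ((a / Num.sqrt n%:R) `^ r * K)%:E)%E.
Proof.
move=> r0 /andP[g00 g01].
have g1 : 0 < 1 - g0 by lra.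
(* From this scale on, the factor 2^(16 n) of the small-ball estimate is
   absorbed by 2^(l0 m), as m >= (1 - g0) n. *)
pose l0 := (Num.truncn (16 / (1 - g0))).+1.
have l0g : 16 < l0%:R * (1 - g0).
  have h : 0 <= 16 / (1 - g0) by rewrite divr_ge0// ltW.
  by rewrite -ltr_pdivrMr//; have /andP[_] := truncn_itv h.
(* The ratio 2^(r - m) of the series is uniformly below 1, since the integer m
   exceeds r and hence is at least the integral part of r plus one. *)
pose q : R := 2 `^ (r - (Num.truncn r).+1%:R).
have q0 : 0 <= q by exact: powR_ge0.
have q1 : q < 1.
  have /andP[_ h] := truncn_itv r0.
  by rewrite /q /powR gt_eqF// -[ltRHS]expR0 ltr_expR pmulr_llt0 ?ln_gt0 ?ltr1n//; lra.
pose B : R := (2 ^+ l0.+1) `^ r.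
have B0 : 0 < B by rewrite powR_gt0// exprn_gt0.
exists ((2 ^+ l0) `^ r + B / (1 - q)).
  by rewrite addr_gt0// ?powR_gt0 ?exprn_gt0// divr_gt0// subr_gt0.
move=> n p p0 pr pg d T P X a a0 iidX.
have n0 : (0 < n)%N.
  rewrite lt0n; apply/eqP => n0; move: pr; rewrite n0.
  have : 1 <= p%:R :> R by rewrite ler1n.
  lra.
have nR : 0 < n%:R :> R by rewrite ltr0n.
have pn' : p%:R <= g0 * n%:R by rewrite -ler_pdivrMr.
have pn : (p <= n)%N.
  by rewrite -(ler_nat R); apply: le_trans pn' _; rewrite ler_piMl// ltW.
pose m := (n - p.-1)%N.
have mE : m%:R = n%:R - p%:R + 1 :> R.
  rewrite /m natrB; last exact: leq_trans (leq_pred p) pn.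
  by rewrite -[in RHS](prednK p0) -natr1; ring.
have mr : (Num.truncn r < m)%N.
  have /andP[h _] := truncn_itv r0.
  by rewrite -(ltr_nat R) mE; apply: le_lt_trans h _; lra.
have nm : (16 * n <= l0 * m)%N.
  rewrite -(ler_nat R) !natrM mE.
  have : 0 <= l0%:R :> R by [].
  nra.
have Lgt i : (1 < 2 ^ (l0 + i))%N by rewrite -{1}(expn0 2) ltn_exp2l.
have /boolp.choice[g gP] : forall i, exists g : T -> \bar R,
    [/\ measurable_fun setT g, forall w, (0 <= g w)%E,
        forall w, smin (random_matrix X w) ^+ 2 <= n%:R / (2 ^ (l0 + i))%:R ^+ 2 ->
          (1 <= g w)%E &
        (\int[P]_w g w <= (2 ^+ (16 * n) / (2 ^ (l0 + i))%:R ^+ m)%:E)%E].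
  by move=> i; exact: single_scale_majorant.
pose c i : R := (2 ^+ (l0 + i.+1)) `^ r.
have c0 i : 0 <= c i by exact: powR_ge0.
have gm i : measurable_fun setT (g i) by have [] := gP i.
have gge0 i w : (0 <= g i w)%E by have [_ h _ _] := gP i; exact: h.
have mcg i : measurable_fun setT (fun w => (c i)%:E * g i w)%E.
  exact: measurable_funeM.
have cg0 i w : (0 <= (c i)%:E * g i w)%E by rewrite mule_ge0 ?lee_fin.
have mser : measurable_fun setT (fun w => \sum_(i <oo) (c i)%:E * g i w)%E.
  exact: (@ge0_emeasurable_sum _ _ _ _ (fun i w => (c i)%:E * g i w)%E xpredT).
have ser0 w : (0 <= \sum_(i <oo) (c i)%:E * g i w)%E by exact: nneseries_ge0.
have l0r0 : (0 <= ((2 ^+ l0 : R) `^ r)%:E)%E by rewrite lee_fin powR_ge0.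
have ab0 : (0 <= ((a / Num.sqrt n%:R) `^ r)%:E)%E by rewrite lee_fin powR_ge0.
rewrite /smin_neg_moment.
apply: (@le_trans _ _ (\int[P]_w (((a / Num.sqrt n%:R) `^ r)%:E *
     (((2 ^+ l0) `^ r)%:E + \sum_(i <oo) (c i)%:E * g i w)))%E).
  apply: ge0_le_integralT => w; first exact: poweR_ge0.
  have [s0 _] := smin_attained (random_matrix X w) p0 pn.
  apply: dyadic_majorant => //; first by rewrite sqrtr_gt0.
  move=> i si; have [_ _ h _] := gP i; apply: h.
  have -> : n%:R / (2 ^ (l0 + i))%:R ^+ 2 = (Num.sqrt n%:R / 2 ^+ (l0 + i)) ^+ 2 :> R.
    by rewrite natrX expr_div_n sqr_sqrtr.
  by apply: lerXn2r si; rewrite nnegrE ?divr_ge0 ?exprn_ge0 ?sqrtr_ge0.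
rewrite ge0_integralZl//; last 2 first.
- by apply: emeasurable_funD.
- by move=> w _; rewrite adde_ge0.
rewrite EFinM; apply: lee_wpmul2l => //.
rewrite ge0_integralD//.
rewrite integral_cst// [X in (_ * X + _)%E](_ : _ = 1%E); last exact: probability_setT.
rewrite mule1 EFinD leeD2l//.
rewrite integral_nneseries//.
apply: le_trans (nneseries_geometric_le (ltW B0) _); last by rewrite q0.
apply: lee_nneseries => [i *|i *]; first by apply: integral_ge0 => w *; exact: cg0.
rewrite ge0_integralZl//; last by rewrite lee_fin.
have [_ _ _ gi] := gP i.
apply: (le_trans (lee_wpmul2l _ gi)); first by rewrite lee_fin.
rewrite -EFinM lee_fin.
have -> : c i = B * (2 `^ r) ^+ i.
  rewrite /c /B addnS -addSn exprD powRM ?exprn_ge0//; congr (_ * _).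
  exact: powR_exprn.
rewrite -mulrA ler_wpM2l ?(ltW B0)//.
have qE : (2 `^ r / 2 ^+ m) ^+ i <= q ^+ i.
  rewrite lerXn2r ?nnegrE ?divr_ge0 ?powR_ge0 ?exprn_ge0//.
  rewrite -powR_mulrn// -powRN -powRD ?pnatr_eq0 ?implybT//.
  by apply: ler_powR; rewrite ?ler1n// lerD2l lerN2 ler_nat.
apply: le_trans qE; rewrite expr_div_n ler_wpM2l ?exprn_ge0 ?powR_ge0//.
rewrite natrX -exprM mulnDl exprD -exprM (mulnC m i).
rewrite invfM mulrA ler_piMl ?invr_ge0 ?exprn_ge0//.
by rewrite ler_pdivrMr ?exprn_gt0// mul1r ler_eXn2l ?ltr1n.
Qed.

Theorem theorem2p2 (R : realType) :
  (exists2 c2 : R, 0 < c2 < 1 &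
   forall r : R, 0 <= r ->
   forall gamma0 : R, 0 < gamma0 < 1 ->
   exists c1 c3 : R, [/\ 0 < c1, 0 < c3 &
     forall n p : nat,
       (0 < p)%N -> (p.+1 < n)%N -> p%:R + r - 1 < n%:R ->
       p%:R / n%:R <= gamma0 ->
       forall (d : measure_display) (T : measurableType d)
         (P : probability T R) (X : 'I_n -> 'I_p -> {RV P >-> R}),
       iid_standard_normal X ->
       (smin_neg_moment X 1 r <=
         (c1 / (n%:R - p%:R - 1) `^ (r / 2) +
          c3 * c2 `^ ((n%:R - p%:R - r + 1) / 2)
            / (n%:R - p%:R - 1) `^ ((r - 4) / 2))%:E)%E])
  /\
  (forall r : R, 0 <= r ->
   forall gamma : R, 0 <= gamma < 1 ->
   exists2 K2 : R, 0 < K2 &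
     forall p : nat -> nat, (forall n, (0 < p n)%N) ->
       (fun n => (p n)%:R / n%:R : R) @ \oo --> gamma ->
       \forall n \near \oo,
         forall (d : measure_display) (T : measurableType d)
           (P : probability T R) (X : 'I_n -> 'I_(p n) -> {RV P >-> R}),
         iid_standard_normal X ->
         (smin_neg_moment X (Num.sqrt n%:R) r <= K2%:E)%E).
Proof.
split.
  exists 2^-1; first lra.
  move=> r r0 g0 g0P; have [K K0 HK] := smin_neg_moment_le r0 g0P.
  exists K, 1; split => // n p p0 pn pr pg d T P X iidX.
  apply: (le_trans (HK n p p0 pr pg d T P X 1 ltr01 iidX)); rewrite lee_fin.
  have pn' : p%:R + 1 < n%:R :> R by rewrite natr1 ltr_nat.
  set s := n%:R - p%:R - 1.
  have s0 : 0 < s by rewrite /s; lra.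
  have sn : s <= n%:R by rewrite /s; have : 0 <= p%:R :> R by []; lra.
  have n0 : 0 < n%:R :> R by exact: lt_le_trans sn.
  apply: (@le_trans _ _ (K / s `^ (r / 2))); last first.
    by rewrite lerDl mul1r divr_ge0 ?powR_ge0.
  rewrite mulrC ler_pM2l// [r / 2]mulrC powRrM powR12_sqrt ?(ltW s0)// div1r.
  have sn0 : 0 < Num.sqrt (n%:R : R) by rewrite sqrtr_gt0.
  rewrite -[leRHS]mul1r ler_pdivlMr ?powR_gt0 ?sqrtr_gt0//.
  rewrite -powRM ?invr_ge0 ?sqrtr_ge0//.
  apply: (@le_trans _ _ (1 `^ r)); last by rewrite powR1.
  apply: ge0_ler_powR; rewrite ?nnegrE ?mulr_ge0 ?invr_ge0 ?sqrtr_ge0//.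
  by rewrite mulrC ler_pdivrMr// mul1r ler_wsqrtr.
move=> r r0 g /andP[g0 g1].
pose g2 := (1 + g) / 2.
have g2P : 0 < g2 < 1 by rewrite /g2; lra.
have [K K0 HK] := smin_neg_moment_le r0 g2P.
exists K => // p p0 cvg_p.
have gg2 : g < g2 by rewrite /g2; lra.
near=> n => d T P X iidX.
have n0 : 0 < n%:R :> R by near: n; exact: nbhs_infty_gtr.
have pg : (p n)%:R / n%:R < g2.
  by near: n; exact: (cvgr_lt _ cvg_p).
have nr : r / (1 - g2) < n%:R by near: n; exact: nbhs_infty_gtr.
have sn0 : 0 < Num.sqrt (n%:R : R) by rewrite sqrtr_gt0.
have := HK n (p n) (p0 n) _ (ltW pg) d T P X _ sn0 iidX.
rewrite divff ?gt_eqF// powR1 mul1r; apply.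
have g21 : 0 < 1 - g2 by case/andP: g2P => *; lra.
move: pg nr; rewrite ltr_pdivrMr// ltr_pdivrMr// => pg nr; clearbody g2; lra.
Unshelve. all: by end_near. Qed.
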